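(* Given integers $0<a<b$, let $D=\gcd(a,b)$ and $$k_{a,b}=\max\left\{b\left(\frac{b-a}{D}-1\right),\ \frac{ba}{D}\right\}.$$ For any integer $j$ denote $H_j=\langle j, j+a, j+b\rangle$. Then $\operatorname{res}(H_j)=\operatorname{res}(H_{j+b})$ for all $j>2k_{a,b}$.
   Context: $\langle n_1,n_2,n_3\rangle$ denotes the submonoid of $(\mathbb{N},+)$ generated by $n_1,n_2,n_3$ (with $0\in\mathbb{N}$). A numerical semigroup $H$ is a submonoid of $\mathbb{N}$ such that $\mathbb{N}\setminus H$ is finite. For such $H$, let $M=H\setminus\{0\}$ and $PF(H)=\{f\in \mathbb{N}\setminus H: f+M\subseteq H\}$. The canonical ideal of $H$ is $\Omega_H=\{-f+h : f\in PF(H),\ h\in H\}\subset\mathbb{Z}$, the anti-canonical ideal is $\Omega_H^{-1}=\{x\in\mathbb{Z}: x+\Omega_H\subseteq H\}$, the trace is $\operatorname{tr}(H)=\Omega_H+\Omega_H^{-1}\subseteq H$, and the residue is $\operatorname{res}(H)=|H\setminus\operatorname{tr}(H)|$. For an arbitrary semigroup $H\subset\mathbb{N}$ containing $0$ (and not equal to $\{0\}$), with $d=\gcd(h:h\in H)$, one defines $\operatorname{res}(H)=\operatorname{res}\left(\frac1d H\right)$. *)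

(* Defs.v *)
From mathcomp Require Import all_boot all_order all_algebra.
From mathcomp Require Import finmap all_classical.
From mathcomp Require Import zify.

Set Implicit Arguments.
Unset Strict Implicit.
Unset Printing Implicit Defensive.

Import Order.TTheory GRing.Theory Num.Theory.

Local Open Scope classical_set_scope.
Local Open Scope ring_scope.

Definition submonoid (H : set nat) : Prop :=
  H 0%N /\ (forall x y : nat, H x -> H y -> H (x + y)%N).

Definition gen3 (n1 n2 n3 : nat) : set nat :=
  smallest submonoid [set n1; n2; n3].

Definition numerical_semigroup (H : set nat) : Prop :=
  submonoid H /\ finite_set (~` H).

Definition PF (H : set nat) : set nat :=
  [set f | ~ H f /\ forall m : nat, H m -> m <> 0%N -> H (f + m)%N].

Definition int_set (H : set nat) : set int := [set h%:Z | h in H].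

Definition canonical_ideal (H : set nat) : set int :=
  [set - f%:Z + h%:Z | f in PF H & h in H].

Definition anticanonical_ideal (H : set nat) : set int :=
  [set x : int | forall y : int,
     canonical_ideal H y -> int_set H (x + y)].

Definition trace (H : set nat) : set int :=
  [set x + y | x in canonical_ideal H & y in anticanonical_ideal H].

(* [fset_set] sends infinite sets to the empty one; [finite_residue] below
   shows that this case does not occur for numerical semigroups H <> N.
   (With [PF] restricted to gaps, [PF N] is empty; the fallback then gives the
   customary value 0 for N.) *)
Definition res_numerical (H : set nat) : nat :=
  #|` fset_set (int_set H `\` trace H)|.

Definition is_gcd_set (H : set nat) (d : nat) : Prop :=
  (forall h : nat, H h -> (d %| h)%N) /\
  (forall e : nat, (forall h : nat, H h -> (e %| h)%N) -> (e %| d)%N).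

Definition gcd_set (H : set nat) : nat := xget 0%N (is_gcd_set H).

Definition res (H : set nat) : nat :=
  res_numerical [set (h %/ gcd_set H)%N | h in H].

Definition H_ (a b j : nat) : set nat := gen3 j (j + a) (j + b).

(* Over nat nothing is truncated for 0 < a < b: gcdn a b divides b - a > 0. *)
Definition k_ (a b : nat) : nat :=
  let D := gcdn a b in
  maxn (b * ((b - a) %/ D - 1)) (b * a %/ D).

Lemma gcd_setP (H : set nat) : is_gcd_set H (gcd_set H).
Proof.
suff [d Hd] : exists d, is_gcd_set H d by exact: (xgetPex 0%N (ex_intro _ d Hd)).
have [H0|] := pselect (forall h, H h -> h = 0%N).
  by exists 0%N; split=> [h /H0 -> //|e _]; exact: dvdn0.
move=> /existsNP[n /not_implyP[Hn /eqP]]; rewrite -lt0n => n_gt0.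
pose comb d := forall e, (forall h, H h -> (e %| h)%N) -> (e %| d)%N.
have : exists d : nat, (0 < d)%N && `[< comb d >].
  by exists n; rewrite n_gt0; apply/asboolP => e; apply.
case/ex_minnP=> d /andP[d_gt0 /asboolP dcomb] dmin.
exists d; split => // h Hh.
have g_gt0 : (0 < gcdn d h)%N by rewrite gcdn_gt0 d_gt0.
have /dmin : (0 < gcdn d h)%N && `[< comb (gcdn d h) >].
  rewrite g_gt0; apply/asboolP => e eH.
  by rewrite dvdn_gcd dcomb // eH.
move=> le_dg; apply/gcdn_idPl/eqP.
by rewrite eqn_leq le_dg dvdn_leq ?dvdn_gcdl.
Qed.

Lemma gen3E (n1 n2 n3 : nat) :
  gen3 n1 n2 n3 =
  [set n | exists x y z : nat, n = (x * n1 + y * n2 + z * n3)%N].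
Proof.
apply/seteqP; split=> [n|n [x [y [z ->]]] S [[S0 SD] Sgen]].
  apply; split.
    split; first by exists 0%N, 0%N, 0%N.
    move=> _ _ [x [y [z ->]]] [x' [y' [z' ->]]].
    exists (x + x')%N, (y + y')%N, (z + z')%N.
    by rewrite !mulnDl addnACA; congr addn; rewrite addnACA.
  move=> _ [[->|->]|->].
  - by exists 1%N, 0%N, 0%N; rewrite mul1n !mul0n !addn0.
  - by exists 0%N, 1%N, 0%N; rewrite mul1n !mul0n addn0.
  - by exists 0%N, 0%N, 1%N; rewrite mul1n !mul0n.
have SM m : S m -> forall k, S (k * m)%N.
  by move=> Sm; elim=> [//|k IHk]; rewrite mulSn; exact: SD.
apply: (SD); first apply: (SD); apply: SM; apply: Sgen.
- by left; left.
- by left; right.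
- by right.
Qed.

Lemma finite_residue (H : set nat) :
  numerical_semigroup H -> H <> [set: nat] ->
  finite_set (int_set H `\` trace H).
Proof.
move=> [[H0 HD] /finite_seqP[s Es]] neT.
have HN n : (\max_(i <- s) i < n)%N -> H n.
  move=> ltn; have [//|nH] := pselect (H n).
  have ns : n \in s by have : (~` H) n by []; rewrite Es.
  by move: ltn; rewrite ltnNge (@leq_bigmax_seq _ s xpredT id n).
set N := (\max_(i <- s) i)%N in HN.
have gapN f : ~ H f -> (f <= N)%N by move=> nf; rewrite leqNgt; apply/negP => /HN.
have [F FPF] : exists F, PF H F.
  have exF : exists f : nat, `[< ~ H f >].
    have /existsNP[f nf] : ~ forall n, H n.
      by move=> allH; apply: neT; apply/seteqP; split.
    by exists f; apply/asboolP.
  have leF (f : nat) : `[< ~ H f >] -> (f <= N)%N by move=> /asboolP/gapN.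
  case: (ex_maxnP exF leF) => F /asboolP nF maxF; exists F; split=> // m _ m0.
  have [//|/asboolP/maxF] := pselect (H (F + m)%N).
  by move: m0 => /eqP; lia.
apply: (@sub_finite_set _ _ [set n%:Z | n in `I_(N + N.+1)]).
  move=> _ [[n Hn <-] ntr]; exists n => //=.
  rewrite ltnNge; apply/negP => le_n; apply: ntr.
  exists (- F%:Z + 0%:Z); first by exists F => //; exists 0%N.
  exists (n + F)%:Z; last by lia.
  move=> _ [f [nf _] [h Hh <-]].
  exists (n + F - f + h)%N; first by apply: HN; move: (gapN _ nf); lia.
  by move: (gapN _ nf); lia.
by apply: finite_image; exact: finite_II.
Qed.

(* Main.v *)
(**
  Dividing out gcd(j, a, b) we may write a = D q, b = D p and j = r q + t p with
  gcd(p, q) = gcd(j, D) = 1 and 0 <= r < p. The relations among the generators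
  n1 = j, n2 = j + a, n3 = j + b form the lattice spanned by
    (- u, p, - q)  and  (c, - r, - t),   where u = p - q and c = D + r + t.
  The bound j > 2 k gives q <= t and 2 u <= c. The Hilbert-Burch matrix of H_j
  then has the rows (x^u, y^(p-r), z^t) and (y^r, z^q, x^(c-u)); its entries
  generate the trace, so that H_j \ tr is the box
    { i n1 + k n2 + l n3 : i < u, k < min(r, p - r), l < q }
  and res(H_j) = u q min(r, p - r). Passing from j to j + b replaces t by t + D
  and c by c + D, and leaves p, q, r unchanged.
*)
Require Import Defs.
From mathcomp Require Import all_boot all_order all_algebra.
From mathcomp Require Import finmap all_classical.
From mathcomp Require Import zify.
Import Order.TTheory GRing.Theory Num.Theory.
Local Open Scope classical_set_scope.
Local Open Scope ring_scope.

(** * Inequalities for vectors of the relation lattice *)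

Section Lattice.
Variables (p q r t c u : int).
Hypotheses (q0 : 0 < q) (u0 : 0 < u) (pE : p = u + q) (r0 : 0 <= r) (rp : r < p)
  (qt : q <= t) (uc : 2 * u <= c).

(* Case analysis on the sign of [B] that supplies the products occurring in the
   lemmas below, which makes their inequalities linear. *)
Lemma sign_ind (P : int -> Prop) :
  (forall B, 1 <= B -> B * q <= B * t -> t <= B * t -> 2 * (B * u) <= B * c ->
     r <= B * r -> 0 <= (B - 1) * r -> B * r <= B * p - B -> P B) ->
  P 0 ->
  (forall B, 1 <= B -> B * q <= B * t -> t <= B * t -> 2 * (B * u) <= B * c ->
     r <= B * r -> 0 <= (B - 1) * r -> B * r <= B * p - B -> P (- B)) ->
  forall B, P B.
Proof.
move=> hpos h0 hneg B; have [B1|[->//|B1]] : 1 <= B \/ B = 0 \/ B <= -1 by lia.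
  by apply: hpos => //; nia.
by rewrite -(opprK B); apply: hneg => //; nia.
Qed.

Let p0 : 0 < p. Proof. by lia. Qed.

(** The difference of two points of the residue box satisfies these lower bounds, so distinct points
    of the box give distinct integers. *)
Lemma box_unique (A B : int) :
  - u < - A * u + B * c -> - r < A * p - B * r -> r - p < A * p - B * r ->
  - q < - A * q - B * t -> A = 0 /\ B = 0.
Proof.
elim/sign_ind: B =>
  [B B1 hq ht hu hr0 hr1 hrp||B B1 hq ht hu hr0 hr1 hrp] h1 h2 h3 h4.
(* Here and below, a bound on [A] is multiplied by [p], [q] or [u] and then follows linearly from
   the hypotheses and the products at hand. Two such bounds leave no integer for [A], except 0 when
   [B] is 0. *)
- have : 0 < A by rewrite -(ltr_pM2r p0); lia.
  have : A < 1 - B by rewrite -(ltr_pM2r q0); lia.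
  lia.
- have : A < 1 by rewrite -(ltr_pM2r u0); lia.
  have : -1 < A by rewrite -(ltr_pM2r p0); lia.
  lia.
- have : A < 1 - 2 * B by rewrite -(ltr_pM2r u0); lia.
  have : -1 - B < A by rewrite -(ltr_pM2r p0); lia.
  lia.
Qed.

(* Here and in [box_add_delta], delta = u n1 - r n2 is the difference of the two
   pseudo-Frobenius numbers. *)
Lemma box_sub_delta (A B : int) :
  - A * u + B * c < 0 -> A * p - B * r < p -> - A * q - B * t < q -> False.
Proof.
elim/sign_ind: B =>
  [B B1 hq ht hu hr0 hr1 hrp||B B1 hq ht hu hr0 hr1 hrp] h1 h2 h3.
- have : 2 * B < A by rewrite -(ltr_pM2r u0); lia.
  have : A < 1 + B by rewrite -(ltr_pM2r p0); lia.
  lia.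
- have : 0 < A by rewrite -(ltr_pM2r u0); lia.
  have : A < 1 by rewrite -(ltr_pM2r p0); lia.
  lia.
- have : B - 1 < A by rewrite -(ltr_pM2r q0); lia.
  have : A < 1 by rewrite -(ltr_pM2r p0); lia.
  lia.
Qed.

Lemma box_add_delta (A B : int) :
  - A * u + B * c < 2 * u -> A * p - B * r < 0 -> - A * q - B * t < q -> False.
Proof.
elim/sign_ind: B =>
  [B B1 hq ht hu hr0 hr1 hrp||B B1 hq ht hu hr0 hr1 hrp] h1 h2 h3.
- have : 2 * B - 2 < A by rewrite -(ltr_pM2r u0); lia.
  have : A < B by rewrite -(ltr_pM2r p0); lia.
  lia.
- have : -1 < A by rewrite -(ltr_pM2r q0); lia.
  have : A < 0 by rewrite -(ltr_pM2r p0); lia.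
  lia.
- have : B - 1 < A by rewrite -(ltr_pM2r q0); lia.
  have : A < 0 by rewrite -(ltr_pM2r p0); lia.
  lia.
Qed.

(* In these lemmas (A, B) relates two representations of an integer f, the first
   being (-1, p-1, t-1), (-1, r-1, t+q-1) or, if f is pseudo-Frobenius, (-1, y, z). *)
Lemma f1_gap (A B : int) :
  1 <= - A * u + B * c -> 1 <= (A + 1) * p - B * r -> A * q + B * t <= t - 1 ->
  False.
Proof.
elim/sign_ind: B =>
  [B B1 hq ht hu hr0 hr1 hrp||B B1 hq ht hu hr0 hr1 hrp] h1 h2 h3.
- have : -1 < A by rewrite -(ltr_pM2r p0); lia.
  have : A < 0 by rewrite -(ltr_pM2r q0); lia.
  lia.
- have : A < 0 by rewrite -(ltr_pM2r u0); lia.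
  have : -1 < A by rewrite -(ltr_pM2r p0); lia.
  lia.
- have : A < - 2 * B by rewrite -(ltr_pM2r u0); lia.
  have : - 1 - B < A by rewrite -(ltr_pM2r p0); lia.
  lia.
Qed.

Lemma f2_gap (A B : int) :
  1 <= - A * u + B * c -> 1 <= r + A * p - B * r ->
  A * q + B * t <= t + q - 1 ->
  False.
Proof.
elim/sign_ind: B =>
  [B B1 hq ht hu hr0 hr1 hrp||B B1 hq ht hu hr0 hr1 hrp] h1 h2 h3.
- have : 0 < A by rewrite -(ltr_pM2r p0); lia.
  have : A < 1 by rewrite -(ltr_pM2r q0); lia.
  lia.
- have : A < 0 by rewrite -(ltr_pM2r u0); lia.
  have : -1 < A by rewrite -(ltr_pM2r p0); lia.
  lia.
- have : A < - 2 * B by rewrite -(ltr_pM2r u0); lia.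
  have : - 1 - B < A by rewrite -(ltr_pM2r p0); lia.
  lia.
Qed.

(** The relation compares f = (-1, y, z) with the representation of f obtained from f + n2. Only A =
    -1 and (A, B) = (0, 1) survive, giving [p - 1] and [r - 1] respectively. *)
Lemma PF_second_coord (A B x y z : int) :
  y < p -> z < t + q ->
  - A * u + B * c = x -> 0 < x -> A * p - B * r = - 1 - y -> 0 <= y ->
  A * q + B * t <= z ->
  y = p - 1 \/ 0 < r /\ y = r - 1.
Proof.
elim/sign_ind: B =>
  [B B1 hq ht hu hr0 hr1 hrp||B B1 hq ht hu hr0 hr1 hrp] h1 h2 h3 h4 h5 h6 h7.
- have [A1|] : A <= -1 \/ -1 < A by lia.
    have : - 1 <= A by rewrite -(ler_pM2r p0); lia.
    left; have ? : A = -1 by lia.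
    by subst A; lia.
  move=> A0; right.
  (* This combines A q + B t <= z < t + q with (B - 1) q <= (B - 1) t. *)
  have : A + B - 1 < 1 by rewrite -(ltr_pM2r q0); nia.
  move=> AB; have [? ?] : A = 0 /\ B = 1 by lia.
  by subst A B; lia.
- have ? : A < 0 by rewrite -(ltr_pM2r u0); lia.
  have ? : -1 <= A by rewrite -(ler_pM2r p0); lia.
  have ? : A = -1 by lia.
  by subst A; lia.
- have : A < - 2 * B by rewrite -(ltr_pM2r u0); lia.
  have : - 1 - B < A by rewrite -(ltr_pM2r p0); lia.
  lia.
Qed.

Lemma PF_third_coord1 (A B z : int) :
  z < t -> 0 <= z -> 1 <= - A * u + B * c -> 1 <= (A + 1) * p - B * r ->
  z + 1 = A * q + B * t -> z = t - 1.
Proof.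
elim/sign_ind: B =>
  [B B1 hq ht hu hr0 hr1 hrp||B B1 hq ht hu hr0 hr1 hrp] h1 h2 h3 h4 h5.
- have ? : -1 < A by rewrite -(ltr_pM2r p0); lia.
  have ? : 0 <= A * q by nia.
  lia.
- have ? : A < 0 by rewrite -(ltr_pM2r u0); lia.
  have : -1 < A by rewrite -(ltr_pM2r p0); lia.
  lia.
- have : A < - 2 * B by rewrite -(ltr_pM2r u0); lia.
  have : - 1 - B < A by rewrite -(ltr_pM2r p0); lia.
  lia.
Qed.

Lemma PF_third_coord2 (A B z : int) :
  z < t + q -> 0 <= z -> 1 <= - A * u + B * c -> 1 <= r + A * p - B * r ->
  z + 1 = A * q + B * t -> z = t + q - 1.
Proof.
elim/sign_ind: B =>
  [B B1 hq ht hu hr0 hr1 hrp||B B1 hq ht hu hr0 hr1 hrp] h1 h2 h3 h4 h5.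
- have ? : 0 < A by rewrite -(ltr_pM2r p0); lia.
  have ? : q <= A * q by nia.
  lia.
- have ? : A < 0 by rewrite -(ltr_pM2r u0); lia.
  have : -1 < A by rewrite -(ltr_pM2r p0); lia.
  lia.
- have : A < - 2 * B by rewrite -(ltr_pM2r u0); lia.
  have : - 1 - B < A by rewrite -(ltr_pM2r p0); lia.
  lia.
Qed.
End Lattice.

(** * Trace and pseudo-Frobenius numbers in terms of generators *)

Lemma int_setE (H : set nat) (n : nat) : int_set H n%:Z = H n.
Proof. by apply/propext; split=> [[m Hm [<-]]|Hn]; last exists n. Qed.

(** The summand h of -f + h can be absorbed into the anti-canonical ideal, and membership in that
    ideal need only be tested on the generators -g of the canonical ideal. *)
Lemma traceE (H : set nat) (x : int) : submonoid H ->
  trace H x <->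
  exists2 f, PF H f & forall g, PF H g -> int_set H (x + f%:Z - g%:Z).
Proof.
move=> [H0 HD]; split=> [[_ [f PFf [h Hh <-]] [z zP <-]]|[f PFf fP]].
  exists f => // g PFg.
  have [|m Hm mE] := zP (- g%:Z + 0%:Z); first by exists g => //; exists 0%N.
  by exists (h + m)%N; [exact: HD|lia].
exists (- f%:Z + 0%:Z); first by exists f => //; exists 0%N.
exists (x + f%:Z); last by lia.
move=> _ [g PFg [h Hh <-]]; have [m Hm mE] := fP g PFg.
by exists (m + h)%N; [exact: HD|lia].
Qed.

Lemma submonoid_gen3 (n1 n2 n3 : nat) : submonoid (gen3 n1 n2 n3).
Proof.
by split=> [S [[]]//|x y Hx Hy S SP]; apply: SP.1.2; [apply: Hx|apply: Hy].
Qed.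

Lemma gen3_int (n1 n2 n3 : nat) (x : int) : int_set (gen3 n1 n2 n3) x <->
  exists i j k : int, [/\ 0 <= i, 0 <= j, 0 <= k &
    x = i * n1%:Z + j * n2%:Z + k * n3%:Z].
Proof.
rewrite gen3E; split=> [[_ [i [j [k ->]]] <-]|[i [j [k [i0 j0 k0 ->]]]]].
  by exists i%:Z, j%:Z, k%:Z; split; lia.
exists (`|i| * n1 + `|j| * n2 + `|k| * n3)%N;
  last by rewrite !PoszD !PoszM !gez0_abs.
by exists `|i|%N, `|j|%N, `|k|%N.
Qed.

Lemma PF_gen3 (n1 n2 n3 f : nat) : (0 < n1)%N -> (0 < n2)%N -> (0 < n3)%N ->
  let H := gen3 n1 n2 n3 in
  PF H f <-> [/\ ~ H f, H (f + n1)%N, H (f + n2)%N & H (f + n3)%N].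
Proof.
move=> n1_gt0 n2_gt0 n3_gt0 H; have [H0 HD] := submonoid_gen3 n1 n2 n3.
have [Hn1 Hn2 Hn3] : [/\ H n1, H n2 & H n3].
  by split=> S [_]; apply; [left; left|left; right|right].
have HE x : H x <-> exists i j k : nat, x = (i * n1 + j * n2 + k * n3)%N.
  by rewrite /H gen3E.
split=> [[nf Hf]|[nf Hf1 Hf2 Hf3]].
  by split=> //; apply: Hf => //; lia.
split=> // m /HE[i [j [k ->]]].
case: i => [|i _].
  case: j => [|j _].
    case: k => [|k _]; first by lia.
    have -> : (f + (0 * n1 + 0 * n2 + k.+1 * n3) =
      f + n3 + (0 * n1 + 0 * n2 + k * n3))%N by lia.
    by apply: HD => //; apply/HE; exists 0%N, 0%N, k.
  have -> : (f + (0 * n1 + j.+1 * n2 + k * n3) =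
      f + n2 + (0 * n1 + j * n2 + k * n3))%N by lia.
  by apply: HD => //; apply/HE; exists 0%N, j, k.
have -> : (f + (i.+1 * n1 + j * n2 + k * n3) =
      f + n1 + (i * n1 + j * n2 + k * n3))%N by lia.
by apply: HD => //; apply/HE; exists i, j, k.
Qed.

(** * Pseudo-Frobenius numbers and residue for coprime generators *)

Section Semigroup.
Variables (D p q r t : nat).
Hypotheses (D_gt0 : (0 < D)%N) (q_gt0 : (0 < q)%N) (qp : (q < p)%N)
  (rp : (r < p)%N) (qt : (q <= t)%N) (uc : (2 * (p - q) <= D + r + t)%N)
  (co_pq : coprime p q) (co_jD : coprime (r * q + t * p) D).

Let j := (r * q + t * p)%N.
Let H := gen3 j (j + D * q) (j + D * p).
Let u : int := p%:Z - q%:Z.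
Let c : int := D%:Z + r%:Z + t%:Z.
Let val (x y z : int) : int :=
  x * j%:Z + y * (j + D * q)%:Z + z * (j + D * p)%:Z.

Let jE : j%:Z = r%:Z * q%:Z + t%:Z * p%:Z.
Proof. by rewrite /j PoszD !PoszM. Qed.

Lemma val_expand (x y z : int) :
  val x y z = (x + y + z) * j%:Z + D%:Z * (y * q%:Z + z * p%:Z).
Proof. by rewrite /val !PoszD !PoszM; lia. Qed.

(** As j is prime to D, D divides x + y + z, and the quotient is B. Inserting j = r q + t p leaves q
    (y + B r) + p (z + B t) = 0, and coprimality of p and q yields A. *)
Lemma relation_lattice (x y z : int) : val x y z = 0 ->
  exists A B : int, [/\ x = - A * u + B * c, y = A * p%:Z - B * r%:Z &
                       z = - A * q%:Z - B * t%:Z].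
Proof.
rewrite val_expand => xyz0.
have /dvdzP[s sE] : (D %| x + y + z)%Z.
  rewrite -(@Gauss_dvdzl _ _ j%:Z);
    last by rewrite /coprimez /gcdz /= eqz_nat gcdnC.
  by apply/dvdzP; exists (- (y * q%:Z + z * p%:Z)); lia.
have eq0 : q%:Z * (y + s * r%:Z) + p%:Z * (z + s * t%:Z) = 0.
  have : D%:Z * (q%:Z * (y + s * r%:Z) + p%:Z * (z + s * t%:Z)) = 0.
    by rewrite -[RHS]xyz0 sE jE; lia.
  by move/eqP; rewrite mulf_eq0 => /orP[|/eqP//]; rewrite eqz_nat; lia.
have /dvdzP[A AE] : (p %| y + s * r%:Z)%Z.
  rewrite -(@Gauss_dvdzl _ _ q%:Z); last by rewrite /coprimez /gcdz /= eqz_nat.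
  by apply/dvdzP; exists (- (z + s * t%:Z)); lia.
have zE : z + s * t%:Z = - A * q%:Z.
  have : p%:Z * (z + s * t%:Z + A * q%:Z) = 0 by rewrite AE in eq0; lia.
  by move/eqP; rewrite mulf_eq0 => /orP[|/eqP]; rewrite ?eqz_nat; lia.
exists A, s; split; rewrite /u /c; lia.
Qed.

Lemma val_lattice (A B : int) :
  val (- A * u + B * c) (A * p%:Z - B * r%:Z) (- A * q%:Z - B * t%:Z) = 0.
Proof. by rewrite val_expand jE /u /c; lia. Qed.

Lemma int_set_val (x y z : int) : int_set H (val x y z) <->
  exists A B : int, [/\ 0 <= x + (- A * u + B * c),
    0 <= y + (A * p%:Z - B * r%:Z) & 0 <= z + (- A * q%:Z - B * t%:Z)].
Proof.
rewrite gen3_int -/H; split=> [[x' [y' [z' [x0 y0 z0 E]]]]|[A [B [x0 y0 z0]]]].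
  have [|A [B [xE yE zE]]] := @relation_lattice (x' - x) (y' - y) (z' - z).
    by move: E; rewrite /val; lia.
  by exists A, B; rewrite -xE -yE -zE; split; lia.
do 3 eexists; split; [exact: x0|exact: y0|exact: z0|].
by move: (val_lattice A B); rewrite /val; lia.
Qed.

Let q0 : 0 < q%:Z. Proof. by lia. Qed.
Let r0 : 0 <= r%:Z. Proof. by lia. Qed.
Let rp' : r%:Z < p%:Z. Proof. by lia. Qed.
Let qt' : q%:Z <= t%:Z. Proof. by lia. Qed.
Let u0 : 0 < u. Proof. by rewrite /u; lia. Qed.
Let pE : p%:Z = u + q%:Z. Proof. by rewrite /u; lia. Qed.
Let uc' : 2 * u <= c. Proof. by rewrite /u /c; lia. Qed.
Let j0 : (0 < j)%N. Proof. by rewrite /j; nia. Qed.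

(* The degrees of the two syzygies minus n1 + n2 + n3; for r = 0 the semigroup
   is symmetric and only the first one is a pseudo-Frobenius number. *)
Let f1 : int := val (-1) (p%:Z - 1) (t%:Z - 1).
Let f2 : int := val (-1) (r%:Z - 1) (t%:Z + q%:Z - 1).

Lemma f1_ge0 : 0 <= f1.
Proof. by rewrite /f1 /val; nia. Qed.

Lemma f2_ge0 : (0 < r)%N -> 0 <= f2.
Proof. by rewrite /f2 /val; nia. Qed.

(** Coordinatewise the difference is (0, p - r, -q); adding the relation (u, -p, q) gives the form
    on the right. *)
Lemma f1_sub_f2 : f1 - f2 = val u (- r%:Z) 0.
Proof. by move: (val_lattice (-1) 0); rewrite /f1 /f2 /val /u; lia. Qed.

Lemma PF_H (f : nat) :
  PF H f <-> f%:Z = f1 \/ (0 < r)%N /\ f%:Z = f2.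
Proof.
rewrite PF_gen3; [|lia..]; rewrite -/H.
rewrite -!(int_setE H) !PoszD; split.
- move=> [nf /gen3_int[x [y [z [x0 y0 z0 E]]]]
    /gen3_int[x' [y' [z' [x'0 y'0 z'0 E']]]]
    /gen3_int[x'' [y'' [z'' [x''0 y''0 z''0 E'']]]]].
  have fE : f%:Z = val (x - 1) y z by rewrite /val; lia.
  have fE' : f%:Z = val x' (y' - 1) z' by rewrite /val; lia.
  have fE'' : f%:Z = val x'' y'' (z'' - 1) by rewrite /val; lia.
  have gapE A B : 0 <= x - 1 + (- A * u + B * c) ->
    0 <= y + (A * p%:Z - B * r%:Z) -> 0 <= z + (- A * q%:Z - B * t%:Z) -> False.
    by move=> h1 h2 h3; apply: nf; rewrite fE; apply/int_set_val; exists A, B.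
  have y'E : y' = 0.
    have [//|y'1] : y' = 0 \/ 1 <= y' by lia.
    by case: nf; rewrite fE'; apply/int_set_val; exists 0, 0; split; lia.
  have z''E : z'' = 0.
    have [//|z''1] : z'' = 0 \/ 1 <= z'' by lia.
    by case: nf; rewrite fE''; apply/int_set_val; exists 0, 0; split; lia.
  subst y' z''.
  (* The pairs (-1, 0), (1, 1), (0, 1) encode the relations y^p = x^u z^q, z^(t+q) = x^(c-u) y^(p-r)
     and y^r z^t = x^c. Applying one of them from left to right would put the gap [f] into [H]. *)
  have xE : x = 0 by have := gapE 0 0; lia.
  have yp : y < p%:Z by have := gapE (-1) 0; lia.
  have ztq : z < t%:Z + q%:Z by have := gapE 1 1; lia.
  have yz : y < r%:Z \/ z < t%:Z by have := gapE 0 1; lia.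
  subst x.
  have [|A [B [xA yA zA]]] := @relation_lattice (x' + 1) (-1 - y) (z' - z).
    by move: fE fE'; rewrite /val; lia.
  have [|A' [B' [xA' yA' zA']]] :=
    @relation_lattice (x'' + 1) (y'' - y) (- 1 - z).
    by move: fE fE''; rewrite /val; lia.
  have [yE|[r_gt0 yE]] : y = p%:Z - 1 \/ 0 < r%:Z /\ y = r%:Z - 1.
  - apply: (@PF_second_coord
      _ _ _ _ _ _ q0 u0 pE r0 rp' qt' uc' A B (x' + 1) y z); by lia.
  - subst y; left; rewrite fE /f1; congr val.
    by apply: (@PF_third_coord1
      _ _ _ _ _ _ q0 u0 pE r0 rp' qt' uc' A' B'); lia.
  - subst y; right; split; first lia.
    rewrite fE /f2; congr val.
    by apply: (@PF_third_coord2
      _ _ _ _ _ _ q0 u0 pE r0 rp' qt' uc' A' B'); lia.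
- have val1 x y z : val x y z + j%:Z = val (x + 1) y z.
    by rewrite /val; lia.
  have val2 x y z : val x y z + (j%:Z + (D * q)%:Z) = val x (y + 1) z.
    by rewrite /val; lia.
  have val3 x y z : val x y z + (j%:Z + (D * p)%:Z) = val x y (z + 1).
    by rewrite /val; lia.
  case=> [->|[r_gt0 ->]]; rewrite /f1 /f2 val1 val2 val3; split.
  + move=> /int_set_val[A [B [h1 h2 h3]]].
    by apply: (@f1_gap _ _ _ _ _ _ q0 u0 pE r0 rp' qt' uc' A B); lia.
  + by apply/int_set_val; exists 0, 0; split; lia.
  (* Adding a generator completes the left side of one of the three relations, whose right side
     contains a power of x that compensates the coordinate -1. *)
  + by apply/int_set_val; exists (-1), 0; split; lia.
  + by apply/int_set_val; exists 0, 1; split; lia.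
  + move=> /int_set_val[A [B [h1 h2 h3]]].
    by apply: (@f2_gap _ _ _ _ _ _ q0 u0 pE r0 rp' qt' uc' A B); lia.
  + by apply/int_set_val; exists 0, 0; split; lia.
  + by apply/int_set_val; exists 0, 1; split; lia.
  + by apply/int_set_val; exists 1, 1; split; lia.
Qed.

(** For r > 0 and x in H, [traceE] says that x avoids the trace iff neither x - delta nor x + delta
    is in [H], where delta = f1 - f2. The first fails once i >= u or k >= p - r, the second once k
    >= r or l >= q. *)
Lemma residue_box : int_set H `\` trace H =
  [set x | exists i k l : nat, [/\ (i < p - q)%N, (k < minn r (p - r))%N,
     (l < q)%N & x = val i%:Z k%:Z l%:Z]].
Proof.
have trP := @traceE H _ (submonoid_gen3 _ _ _).
have PF1 : PF H `|f1|%N by apply/PF_H; left; rewrite gez0_abs ?f1_ge0.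
apply/seteqP; split=> x /=.
- move=> [/gen3_int[i [k [l [i0 k0 l0 xE]]]] /trP ntr].
  have {}xE : x = val i k l by [].
  have xHx : int_set H x.
    by rewrite xE; apply/int_set_val; exists 0, 0; split; lia.
  (* For r = 0 there is one pseudo-Frobenius number, so the trace is all of [H]; the box is empty as
     well. *)
  have [r_eq0|r_gt0] : r = 0%N \/ (0 < r)%N by lia.
    case: ntr; exists `|f1|%N => // g /PF_H[|[]]; last lia.
    by move=> ->; rewrite gez0_abs ?f1_ge0 // addrK.
  have PF2 : PF H `|f2|%N.
    by apply/PF_H; right; rewrite gez0_abs ?f2_ge0.
  have nsub : ~ int_set H (x + f2 - f1).
    move=> Hx; apply: ntr; exists `|f2|%N => // g /PF_H[->|[_ ->]];
      rewrite gez0_abs ?f2_ge0 //; by rewrite addrK.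
  have nadd : ~ int_set H (x + f1 - f2).
    move=> Hx; apply: ntr; exists `|f1|%N => // g /PF_H[->|[_ ->]];
      rewrite gez0_abs ?f1_ge0 //; by rewrite addrK.
  have subE : x + f2 - f1 = val (i - u) (k + r%:Z) l.
    by move: f1_sub_f2; rewrite xE /val; lia.
  have addE : x + f1 - f2 = val (i + u) (k - r%:Z) l.
    by move: f1_sub_f2; rewrite xE /val; lia.
  rewrite subE in nsub; rewrite addE in nadd.
  have iu : i < u.
    have [//|ui] : i < u \/ u <= i by lia.
    by case: nsub; apply/int_set_val; exists 0, 0; split; lia.
  have kr : k < r%:Z.
    have [//|rk] : k < r%:Z \/ r%:Z <= k by lia.
    by case: nadd; apply/int_set_val; exists 0, 0; split; lia.
  have kpr : k < p%:Z - r%:Z.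
    have [//|rk] : k < p%:Z - r%:Z \/ p%:Z - r%:Z <= k by lia.
    by case: nsub; apply/int_set_val; exists (-1), 0; split; lia.
  have lq : l < q%:Z.
    have [//|ql] : l < q%:Z \/ q%:Z <= l by lia.
    by case: nadd; apply/int_set_val; exists 1, 0; split; lia.
  by exists `|i|%N, `|k|%N, `|l|%N; split; rewrite ?gez0_abs //; lia.
- move=> [i [k [l [iu km lq xE]]]].
  have subE : x + f2 - f1 = val (i%:Z - u) (k%:Z + r%:Z) l.
    by move: f1_sub_f2; rewrite xE /val; lia.
  have addE : x + f1 - f2 = val (i%:Z + u) (k%:Z - r%:Z) l.
    by move: f1_sub_f2; rewrite xE /val; lia.
  split; first by rewrite xE; apply/int_set_val; exists 0, 0; split; lia.
  have PF2 : PF H `|f2|%N.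
    by apply/PF_H; right; rewrite gez0_abs ?f2_ge0; lia.
  move=> /trP[f /PF_H[fE|[_ fE]] fP].
    have := fP _ PF2; rewrite fE gez0_abs; last by apply: f2_ge0; lia.
    rewrite addE => /int_set_val[A [B [h1 h2 h3]]].
    (* Negating [A] and [B] turns the lower bounds given by membership into the upper bounds of the
       lattice lemma. *)
    by apply: (@box_add_delta
        _ _ _ _ _ _ q0 u0 pE r0 rp' qt' uc' (- A) (- B)); lia.
  have := fP _ PF1; rewrite fE gez0_abs; last exact: f1_ge0.
  rewrite subE => /int_set_val[A [B [h1 h2 h3]]].
  by apply: (@box_sub_delta
        _ _ _ _ _ _ q0 u0 pE r0 rp' qt' uc' (- A) (- B)); lia.
Qed.

Lemma res_numerical_H : res_numerical H = ((p - q) * minn r (p - r) * q)%N.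
Proof.
pose g (w : 'I_(p - q) * 'I_(minn r (p - r)) * 'I_q) :=
  val w.1.1%:Z w.1.2%:Z w.2%:Z.
have g_inj : injective g.
  move=> [[i k] l] [[i' k'] l']; rewrite /g /= => E.
  have [|A [B [iE kE lE]]] :=
    @relation_lattice (i%:Z - i'%:Z) (k%:Z - k'%:Z) (l%:Z - l'%:Z).
    by move: E; rewrite /val; lia.
  have [A0 B0] : A = 0 /\ B = 0.
    by apply: (@box_unique _ _ _ _ _ _ q0 u0 pE r0 rp' qt' uc' A B);
      move: (ltn_ord i) (ltn_ord i') (ltn_ord k) (ltn_ord k');
      move: (ltn_ord l) (ltn_ord l'); lia.
  by subst A B; congr (_, _, _); apply: val_inj => /=; lia.
have -> : res_numerical H = #|` [fset g w | w in
    {: 'I_(p - q) * 'I_(minn r (p - r)) * 'I_q}]%fset|.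
  rewrite /res_numerical residue_box.
  rewrite -[in RHS](set_fsetK [fset _ | _ in _]%fset).
  congr (#|` fset_set _|); apply/seteqP; split=> x /=.
    move=> [i [k [l [iu km lq ->]]]]; apply/imfsetP.
    by exists (Ordinal iu, Ordinal km, Ordinal lq).
  by move=> /imfsetP[[[i k] l] _ ->]; exists i, k, l; split.
by rewrite card_imfset //= -cardE !card_prod !card_ord.
Qed.
End Semigroup.

(** * Reduction to coprime generators and comparison of j with j + b *)

Lemma gcd_set_unique (H : set nat) (d : nat) : is_gcd_set H d -> gcd_set H = d.
Proof.
move=> [dH Hd]; have [gH Hg] := gcd_setP H.
by apply/eqP; rewrite eqn_dvd Hd // Hg.
Qed.

Lemma res_gen3 (d n1 n2 n3 : nat) : (0 < d)%N -> gcdn n1 (gcdn n2 n3) = 1%N ->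
  res (gen3 (d * n1) (d * n2) (d * n3)) = res_numerical (gen3 n1 n2 n3).
Proof.
move=> d_gt0 co; rewrite /res (@gcd_set_unique _ d).
  congr res_numerical; rewrite !gen3E; apply/seteqP; split=> x /=.
    move=> [_ [i [k [l ->]]] <-]; exists i, k, l.
    have -> : (i * (d * n1) + k * (d * n2) + l * (d * n3) =
        d * (i * n1 + k * n2 + l * n3))%N by lia.
    by rewrite mulKn.
  move=> [i [k [l ->]]]; exists (d * (i * n1 + k * n2 + l * n3))%N;
    last by rewrite mulKn.
  by exists i, k, l; lia.
split=> [h|e eH].
  rewrite gen3E => -[i [k [l ->]]].
  by rewrite !dvdn_add // dvdn_mull // dvdn_mulr.
have [e1 e2 e3] : [/\ e %| d * n1, e %| d * n2 & e %| d * n3]%N.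
  by split; apply: eH => S [_]; apply; [left; left|left; right|right].
by rewrite -(muln1 d) -co !muln_gcdr !dvdn_gcd e1 e2 e3.
Qed.

Lemma mod_repr (p q j : nat) :
  (0 < q)%N -> (0 < p)%N -> coprime p q -> (p * q <= j)%N ->
  exists r t : nat, (r < p)%N /\ j = (r * q + t * p)%N.
Proof.
move=> q_gt0 p_gt0 co_pq le_j.
have [x y xyE _] := egcdnP p q_gt0.
have {}xyE : (x * q = y * p + 1)%N by rewrite xyE gcdnC (eqP co_pq).
(* Since [x] inverts [q] modulo [p], this remainder times [q] is congruent to [j]. *)
exists ((j * x) %% p)%N, ((j - (j * x) %% p * q) %/ p)%N.
rewrite ltn_pmod //; split=> //.
have le_r : ((j * x) %% p * q <= j)%N.
  by rewrite (leq_trans _ le_j) // leq_mul2r ltnW ?orbT ?ltn_pmod.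
rewrite divnK ?subnKC //.
rewrite -eqn_mod_dvd // eq_sym modnMml -mulnA xyE mulnDr mulnA.
by rewrite modnMDl muln1.
Qed.

Lemma res_H (d D p q r t : nat) :
  (0 < d)%N -> (0 < D)%N -> (0 < q)%N -> (q < p)%N -> (r < p)%N -> (q <= t)%N ->
  (2 * (p - q) <= D + r + t)%N -> coprime p q -> coprime (r * q + t * p) D ->
  res (H_ (d * (D * q)) (d * (D * p)) (d * (r * q + t * p))) =
    ((p - q) * minn r (p - r) * q)%N.
Proof.
move=> d_gt0 D_gt0 q_gt0 qp rp qt uc co_pq co_jD.
rewrite /H_ -!mulnDr res_gen3 //; first exact: res_numerical_H.
apply/eqP; rewrite -dvdn1; set g := gcdn _ _.
have /and3P[gj ga gb] : [&& g %| r * q + t * p, g %| r * q + t * p + D * q &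
    g %| r * q + t * p + D * p]%N by rewrite -!dvdn_gcd.
rewrite dvdn_addr // in ga; rewrite dvdn_addr // in gb.
have gD : (g %| D)%N.
  by rewrite -(muln1 D) -(eqP co_pq) muln_gcdr dvdn_gcd ga gb.
by rewrite -(eqP co_jD) dvdn_gcd gj.
Qed.

Theorem theorem3p2 (a b : nat) (ha : (0 < a)%N) (hab : (a < b)%N) :
  forall j : nat, (2 * k_ a b < j)%N -> res (H_ a b j) = res (H_ a b (j + b)%N).
Proof.
move=> j; rewrite /k_; set D0 := gcdn a b => lt_kj.
have D0_gt0 : (0 < D0)%N by rewrite gcdn_gt0 ha.
have /dvdnP[q aE] : (D0 %| a)%N by exact: dvdn_gcdl.
have /dvdnP[p bE] : (D0 %| b)%N by exact: dvdn_gcdr.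
have co_pq : coprime p q.
  by rewrite coprime_sym /coprime -(eqn_pmul2r D0_gt0) mul1n muln_gcdl -aE -bE.
pose d := gcdn j D0.
have d_gt0 : (0 < d)%N by rewrite gcdn_gt0 D0_gt0 orbT.
have /dvdnP[j' jE] : (d %| j)%N by exact: dvdn_gcdl.
have /dvdnP[D DE] : (d %| D0)%N by exact: dvdn_gcdr.
have co_jD : coprime j' D.
  by rewrite /coprime -(eqn_pmul2r d_gt0) mul1n muln_gcdl -jE -DE.
have qp : (q < p)%N by rewrite -(ltn_pmul2r D0_gt0) -aE -bE.
have q_gt0 : (0 < q)%N by move: ha; rewrite aE muln_gt0 => /andP[].
have D_gt0 : (0 < D)%N by move: D0_gt0; rewrite DE muln_gt0 => /andP[].
(* [lt1] and [lt2] come from the two terms of the maximum, divided by [d]: b / d = p D, (b - a) / D0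
   = p - q and a / D0 = q. *)
have lt1 : (2 * (p * D * (p - q - 1)) < j')%N.
  rewrite -(ltn_pmul2r d_gt0) -jE (leq_ltn_trans _ lt_kj) //.
  rewrite -mulnA leq_mul2l /= (leq_trans _ (leq_maxl _ _)) //.
  by rewrite {2}bE aE -mulnBl mulnK // {1}bE DE mulnAC mulnA.
have lt2 : (2 * (p * D * q) < j')%N.
  rewrite -(ltn_pmul2r d_gt0) -jE (leq_ltn_trans _ lt_kj) //.
  rewrite -mulnA leq_mul2l /= (leq_trans _ (leq_maxr _ _)) //.
  by rewrite aE mulnA mulnK // bE DE mulnAC mulnA.
have le_pq : (p * q <= p * D * q)%N by rewrite leq_mul2r leq_pmulr // orbT.
have [||//||r [t [rp j'E]]] := @mod_repr p q j'; [lia..|].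
have bE' : b = (d * (D * p))%N by rewrite bE DE; lia.
have aE' : a = (d * (D * q))%N by rewrite aE DE; lia.
have jE' : j = (d * (r * q + t * p))%N by rewrite jE j'E mulnC.
have jbE : (j + b)%N = (d * (r * q + (t + D) * p))%N by rewrite jE' bE'; lia.
have le_rq : (r * q <= p * q)%N by rewrite leq_mul2r ltnW ?orbT.
have qt : (q <= t)%N.
  by rewrite -(@leq_pmul2r p) 1?mulnC; lia.
have uc : (2 * (p - q) <= D + r + t)%N.
  (* Here [u] is p - q - 1, one less than in the lattice section. Then p (2 u + 1) <= 2 p D u + p D
     < j' + p D <= p (D + r + t). *)
  have [u uE] : exists u, (p = u.+1 + q)%N by exists (p - q).-1; lia.
  have -> : (2 * (p - q) = (2 * u + 1).+1)%N by lia.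
  rewrite -(@ltn_pmul2l p); last by lia.
  have : (p * (2 * u + 1) <= p * (2 * u + 1) * D)%N by rewrite leq_pmulr.
  have : (r * q <= r * p)%N by rewrite leq_mul2l ltnW ?orbT.
  have : (2 * (p * D * u) < j')%N by move: lt1; rewrite {2}uE addnK subn1.
  by rewrite j'E; lia.
rewrite jbE jE' aE' bE' !res_H //; rewrite -?j'E //; [lia|lia|].
rewrite mulnDl addnA -j'E /coprime.
by rewrite gcdnC addnC mulnC gcdnMDl gcdnC.
Qed.
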